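(* The forward dynamic programming algorithm (Algorithm 1, described in the context) solves problem $(\mathrm{P})$ correctly; that is, for every input $\Sigma=\{A_1,\ldots,A_m\}\subseteq\mathbb{Z}^{n\times n}$, $a\in\mathbb{Z}^n$, positive integer $K$ and convex function $f:\mathbb{R}^n\to\mathbb{R}$, the matrix sequence $T_0,\ldots,T_{K-1}\in\Sigma$ that it returns maximizes $f(T_{K-1}T_{K-2}\cdots T_0a)$ over all sequences of $K$ matrices from $\Sigma$.
   Context: Problem $(\mathrm{P})$: given a finite set $\Sigma$ of $n\times n$ matrices, an initial vector $a$, a positive integer $K$, and a convex function $f:\mathbb{R}^n\to\mathbb{R}$, find a sequence of $K$ matrices $T_0,\ldots,T_{K-1}\in\Sigma$ (repetition allowed) maximizing $f(x(K))$, where $x(0)=a$ and $x(k+1)=T_kx(k)$ for $k=0,\ldots,K-1$. Notation: $\mathrm{conv}(S)$ is the convex hull of $S$; for a matrix $T$ and a set $S$, $TS=\{Tx\mid x\in S\}$. Algorithm 1. Input: $\Sigma=\{A_1,\ldots,A_m\}\subseteq\mathbb{Z}^{n\times n}$, $a\in\mathbb{Z}^n$, a value oracle for $f$, and $K$. (1) Set $E_0=\{a\}$. (2) For $k=0,1,\ldots,K-1$: set $F_k^i=A_iE_k$ for $i=1,\ldots,m$; then, for each point $x\in\bigcup_{i=1}^mF_k^i$, check (by solving a linear program) whether $x$ is an extreme point of $\mathrm{conv}(\bigcup_{i=1}^mF_k^i)$, and let $E_{k+1}$ be the set of all extreme points of $\mathrm{conv}(\bigcup_{i=1}^mF_k^i)$.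 (3) Find $x^*(K)\in\arg\max\{f(x)\mid x\in E_K\}$ by enumeration. (4) Retrieve and return a matrix sequence $T_{K-1},\ldots,T_0$ that generated $x^*(K)$, i.e. with $x^*(K)=T_{K-1}\cdots T_0a$ (by backtracking through the construction of the sets $E_k$). *)

(* Defs.v *)
(* MathComp + MathComp-Analysis *)
From HB Require Import structures.
From mathcomp Require Import all_boot all_order all_algebra.
From mathcomp Require Import finmap.
From mathcomp Require Import interval_inference boolp classical_sets reals.
From mathcomp Require Import convex.

Set Implicit Arguments.
Unset Strict Implicit.
Unset Printing Implicit Defensive.

Import Order.TTheory GRing.Theory Num.Theory.

Local Open Scope classical_set_scope.
Local Open Scope ring_scope.
Local Open Scope convex_scope.

Definition convex_hull (R : numDomainType) (M : lmodType R)
    (S : set (convex_lmodType M)) : set (convex_lmodType M) :=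
  smallest (@convex_set R M) S.

Definition extreme_points (R : numDomainType) (M : lmodType R)
    (C : set (convex_lmodType M)) : set (convex_lmodType M) :=
  [set x | C x /\
    forall (y z : convex_lmodType M) (t : {i01 R}),
      C y -> C z -> 0 < t%:num < 1 -> x = y <| t |> z -> y = x /\ z = x].

(* A sequence of matrices is listed in order of application:
   T = [:: T_0; ...; T_(K-1)], and the final state is T_(K-1) *m ... *m T_0 *m a *)
Definition final_state (R : realType) (n : nat) (a : 'cV[R]_n)
    (T : seq 'M[R]_n) : 'cV[R]_n :=
  foldl (fun x A => A *m x) a T.

Definition feasible (R : realType) (n : nat) (Sigma : {fset 'M[R]_n})
    (K : nat) (T : seq 'M[R]_n) : Prop :=
  size T = K /\ {subset T <= Sigma}.

Definition solves_P (R : realType) (n : nat) (Sigma : {fset 'M[R]_n})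
    (a : 'cV[R]_n) (K : nat) (f : 'cV[R]_n -> R) (T : seq 'M[R]_n) : Prop :=
  feasible Sigma K T /\
  forall T', feasible Sigma K T' -> f (final_state a T') <= f (final_state a T).

Definition images (R : realType) (n : nat) (Sigma : {fset 'M[R]_n})
    (E : {fset 'cV[R]_n}) : {fset 'cV[R]_n} :=
  (\bigcup_(A <- Sigma) [fset A *m x | x in E])%fset.

(* The linear program deciding whether a point is extreme is modelled by its
   outcome: the points of the union that are extreme in its convex hull are
   exactly those retained *)
Definition extreme_filter (R : realType) (n : nat)
    (F : {fset 'cV[R]_n}) : {fset 'cV[R]_n} :=
  [fset x in F | x \in extreme_points (convex_hull [set` F])]%fset.

Fixpoint stage (R : realType) (n : nat) (Sigma : {fset 'M[R]_n})
    (a : 'cV[R]_n) (k : nat) : {fset 'cV[R]_n} :=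
  if k is k'.+1 then extreme_filter (images Sigma (stage Sigma a k'))
  else [fset a]%fset.

(* [backtrack Sigma a k x T]: backtracking from [x] at stage [k] may retrieve
   [T].  Any predecessor [y] of [x] in the preceding stage may be picked. *)
Inductive backtrack (R : realType) (n : nat) (Sigma : {fset 'M[R]_n})
    (a : 'cV[R]_n) : nat -> 'cV[R]_n -> seq 'M[R]_n -> Prop :=
| backtrack0 : backtrack Sigma a 0 a [::]
| backtrackS (k : nat) (x y : 'cV[R]_n) (A : 'M[R]_n) (T : seq 'M[R]_n) :
    y \in stage Sigma a k -> A \in Sigma -> x = A *m y ->
    backtrack Sigma a k y T -> backtrack Sigma a k.+1 x (rcons T A).

(* The algorithm is nondeterministic, in its choice of a maximizer and in the
   backtracking: it is the relation between an input and its possible outputs *)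
Definition forward_dp (R : realType) (n : nat) (Sigma : {fset 'M[R]_n})
    (a : 'cV[R]_n) (K : nat) (f : 'cV[R]_n -> R) (T : seq 'M[R]_n) : Prop :=
  exists xmax : 'cV[R]_n,
    [/\ xmax \in stage Sigma a K,
        {in stage Sigma a K, forall x, f x <= f xmax}
      & backtrack Sigma a K xmax T].

(* Main.v *)
(* A convex function attains its maximum over the hull of a finite set at an
   extreme point, and linear maps commute with convex hulls. Hence every state
   reachable in k steps lies in the hull of the k-th stage, and discarding the
   non-extreme points does not lose the maximum. The only substantial ingredient
   is Minkowski's theorem for a finite set F: choose H minimal in F with F in
   the hull of H; then no x in H lies in the hull of H minus x, and this forces
   x to be extreme in the hull of F. *)
Require Import Defs.
From HB Require Import structures.
From mathcomp Require Import all_boot all_order all_algebra.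
From mathcomp Require Import finmap.
From mathcomp Require Import interval_inference boolp classical_sets reals.
From mathcomp Require Import convex.
From mathcomp Require Import ring lra.

Set Implicit Arguments.
Unset Strict Implicit.
Unset Printing Implicit Defensive.

Import Order.TTheory GRing.Theory Num.Theory.

Local Open Scope classical_set_scope.
Local Open Scope ring_scope.

(** * Convex hulls and extreme points over an ordered field *)

Section ConvexHull.
Variables (R : realFieldType) (M : lmodType R).
Implicit Types (S C : set (convex_lmodType M)) (x y z u v p q : M).
Implicit Types (F G H : {fset M}).

Lemma convex_setP C :
  convex_set C <->
  forall x y (t : {i01 R}), C x -> C y -> C (t%:num *: x + (1 - t%:num) *: y).
Proof.
split=> [cC x y t Cx Cy|cC x y t]; first by apply/set_mem/cC; exact/mem_set.
by rewrite !inE; exact: cC.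
Qed.

Lemma convex_hull_convex S : convex_set (convex_hull S).
Proof.
apply/convex_setP => x y t Sx Sy C [cC SC].
by move/convex_setP: (cC); apply; [apply: Sx|apply: Sy].
Qed.

Lemma sub_convex_hull S : S `<=` convex_hull S.
Proof. exact: sub_gen_smallest. Qed.

Lemma convex_hull_min S C : convex_set C -> S `<=` C -> convex_hull S `<=` C.
Proof. exact: smallest_sub. Qed.

Lemma convex_hull_sub S C :
  S `<=` convex_hull C -> convex_hull S `<=` convex_hull C.
Proof. by apply: convex_hull_min; exact: convex_hull_convex. Qed.

Lemma convex_hull_set0 : convex_hull (set0 : set (convex_lmodType M)) = set0.
Proof. by apply/smallest_id/convex_setP. Qed.

(* The dilate c C, except that the dilate by 0 is {0} even for empty C. *)
Let dilate C (c : R) : set M :=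
  [set p | exists2 u, c = 0 \/ C u & p = c *: u].

(** When [c + d] is positive, [c *: u + d *: v] is [c + d] times the convex combination of [u] and
    [v] with weights [c / (c + d)] and [d / (c + d)]. Otherwise both coefficients vanish. *)
Let dilateD C c d p q : convex_set C -> 0 <= c -> 0 <= d ->
  dilate C c p -> dilate C d q -> dilate C (c + d) (p + q).
Proof.
move=> /convex_setP cC c0 d0 [u [->|Cu] ->] [v Cv ->].
  by rewrite scale0r !add0r; exists v.
case: Cv => [->|Cv]; first by rewrite scale0r !addr0; exists u => //; right.
have [e0|e0] := eqVneq (c + d) 0.
  have -> : c = 0 by lra.
  have -> : d = 0 by lra.
  by exists 0; [left; rewrite addr0|rewrite !scale0r addr0 scaler0].
have e_gt0 : 0 < c + d by rewrite lt_neqAle eq_sym e0 addr_ge0.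
have t0 : 0 <= c / (c + d) by rewrite divr_ge0 // addr_ge0.
have t1 : c / (c + d) <= 1 by rewrite ler_pdivrMr // mul1r lerDl.
exists ((c / (c + d)) *: u + (1 - c / (c + d)) *: v).
  by right; exact: (cC u v (Itv01 t0 t1)).
by rewrite scalerDr !scalerA; congr (_ *: _ + _ *: _); field.
Qed.

Let dilateZ C t c p : dilate C c p -> dilate C (t * c) (t *: p).
Proof.
by move=> [u cu ->]; exists u; rewrite ?scalerA //; case: cu => [->|];
  [left; rewrite mulr0|right].
Qed.

(** The points of this form make up a convex set, by [dilateD]; it contains [x] (take [c = 0]) and
    [C] (take [c = 1]). *)
Let convex_hull_setU1 C x p : convex_set C -> convex_hull (x |` C) p ->
  exists c k, [/\ 0 <= c <= 1, dilate C c k & p = (1 - c) *: x + k].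
Proof.
move=> cC; pose J := [set p | exists c k,
  [/\ 0 <= c <= 1, dilate C c k & p = (1 - c) *: x + k]].
suff : convex_hull (x |` C) `<=` J by apply.
apply: convex_hull_min => [|q [->|Cq]].
- apply/convex_setP => _ _ t [c [k [c01 ck ->]]] [d [l [d01 dl ->]]].
  have t0 : 0 <= t%:num by [].
  have t1 : t%:num <= 1 by [].
  exists (t%:num * c + (1 - t%:num) * d), (t%:num *: k + (1 - t%:num) *: l).
  split; first by apply/andP; split; nra.
    by apply: dilateD; [| nra | nra | exact: dilateZ | exact: dilateZ].
  rewrite !scalerDr !scalerA addrACA -scalerDl; congr (_ *: _ + _); ring.
- exists 0, 0; split; rewrite ?lexx ?ler01 //.
    by exists 0; [left|rewrite scale0r].
  by rewrite subr0 scale1r addr0.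
- exists 1, q; split; rewrite ?lexx ?ler01 //.
    by exists q; rewrite ?scale1r //; right.
  by rewrite subrr scale0r add0r.
Qed.

Lemma extreme_convex_hull_setU1 C x : convex_set C -> ~ C x ->
  extreme_points (convex_hull (x |` C)) x.
Proof.
move=> cC Cx; split=> [|y z t]; first by apply: sub_convex_hull; left.
move=> /(convex_hull_setU1 cC)[c [k [/andP[c0 c1] ck yE]]].
move=> /(convex_hull_setU1 cC)[d [l [/andP[d0 d1] dl zE]]] /andP[t0 t1] xE.
have [u eu uE] : dilate C (t%:num * c + (1 - t%:num) * d)
    (t%:num *: k + (1 - t%:num) *: l).
  by apply: dilateD; [| nra | nra | exact: dilateZ | exact: dilateZ].
set e := _ + _ in eu uE.
have eE : e *: x = e *: u.
  (* After [(1 - e) *: x] is added, the left side is [x] and the right side is the given combination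
     of [y] and [z]. *)
  rewrite -uE; apply: (addrI ((1 - e) *: x)).
  rewrite -scalerDl subrK scale1r.
  transitivity (t%:num *: y + (1 - t%:num) *: z); first exact: xE.
  rewrite yE zE !scalerDr !scalerA addrACA -scalerDl.
  by congr (_ *: _ + _); rewrite /e; ring.
have e0 : e = 0.
  (* If [e] were nonzero, [u] would lie in [C] and cancelling [e] would give [x = u], against
     [~ C x]. *)
  case: eu => // Cu; apply/eqP/negP => /negP e0.
  by apply: Cx; rewrite (scalerI e0 eE).
(* [e] is a sum of nonnegative terms in which [c] and [d] carry positive weights, because
   [0 < t < 1]. *)
have c_eq0 : c = 0 by rewrite /e in e0; nra.
have d_eq0 : d = 0 by rewrite /e in e0; nra.
case: ck dl yE zE => u1 _ -> [u2 _ ->] -> ->.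
by rewrite c_eq0 d_eq0 !subr0 !scale1r !scale0r !addr0.
Qed.

Lemma irredundant_subset F : exists H, [/\ (H `<=` F)%fset,
  [set` F] `<=` convex_hull [set` H] &
  forall x, x \in H -> ~ convex_hull [set` (H `\ x)%fset] x].
Proof.
have [m] := ubnP #|` F|; elim: m F => // m IH F Fm.
have [[x xF Fx]|noF] :=
    pselect (exists2 x, x \in F & convex_hull [set` (F `\ x)%fset] x); last first.
  exists F; split=> // [|x xF Fx]; first exact: sub_convex_hull.
  by apply: noF; exists x.
have [|H [HF FH Hirr]] := IH (F `\ x)%fset.
  by move: Fm; rewrite (cardfsD1 x) xF.
exists H; split=> //; first exact: fsubset_trans HF (fsubD1set _ _).
have hull_sub := convex_hull_sub FH.
move=> y /= yF; have [->|yx] := eqVneq y x; first exact: hull_sub.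
by apply: FH; rewrite /= !inE yx.
Qed.

Lemma minkowski_fset F :
  [set` F] `<=`
  convex_hull ([set` F] `&` extreme_points (convex_hull [set` F])).
Proof.
have [H [HF FH Hirr]] := irredundant_subset F.
have HF' : [set` H] `<=` [set` F] by move=> x /= /(fsubsetP HF).
suff extH : [set` H] `<=` extreme_points (convex_hull [set` F]).
  apply: subset_trans FH _; apply: convex_hull_sub => x Hx.
  by apply: sub_convex_hull; split; [exact: HF'|exact: extH].
move=> x Hx; pose C := convex_hull [set` (H `\ x)%fset].
(* With the hull written this way, irredundancy of [H] says that [x] lies outside the convex set
   [C], so [extreme_convex_hull_setU1] applies. *)
suff -> : convex_hull [set` F] = convex_hull (x |` C).
  by apply: extreme_convex_hull_setU1 (Hirr _ Hx); exact: convex_hull_convex.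
have sub_H : C `<=` convex_hull [set` H].
  apply: convex_hull_sub => y /=; rewrite !inE => /andP[_ yH].
  exact: sub_convex_hull.
apply/seteqP; split; apply: convex_hull_sub.
  apply: subset_trans FH _; apply: convex_hull_sub => y /= yH.
  apply: sub_convex_hull; have [->|yx] := eqVneq y x; first by left.
  by right; apply: sub_convex_hull; rewrite /= !inE yx.
move=> y [->|/sub_H]; first by apply: sub_convex_hull; exact: HF'.
by apply: convex_hull_sub => z /HF' /sub_convex_hull.
Qed.

(** Sublevel sets of a convex function are convex, so one that contains [S] contains its hull. *)
Lemma convex_function_le_hull S (f : M -> R) (b : R) :
  convex_function [set: M] f -> (forall x, S x -> f x <= b) ->
  forall x, convex_hull S x -> f x <= b.
Proof.
move=> cf Sb; apply: (@convex_hull_min S [set x | f x <= b]) => //.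
apply/convex_setP => x y t /= xb yb.
apply: (le_trans (cf t x y (mem_set I) (mem_set I))).
have t0 : 0 <= t%:num by [].
have t1 : t%:num <= 1 by [].
change (t%:num * f x + (1 - t%:num) * f y <= b); nra.
Qed.

End ConvexHull.

(** The preimage of a convex set under a linear map is convex. *)
Lemma convex_hull_linear (R : realFieldType) (M N : lmodType R)
    (g : {linear M -> N}) (S : set (convex_lmodType M)) (x : M) :
  convex_hull S x ->
  convex_hull ([set g y | y in S] : set (convex_lmodType N)) (g x).
Proof.
apply: (@convex_hull_min _ _ S (g @^-1` convex_hull (g @` S))).
  apply/convex_setP => y z t /= gy gz; rewrite linearD !linearZ.
  by move/convex_setP: (@convex_hull_convex _ N (g @` S)); apply.
by move=> y Sy; apply: sub_convex_hull; exists y.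
Qed.

Lemma fset_argmax (T : choiceType) (d : Order.disp_t) (L : orderType d)
    (f : T -> L) (E : {fset T}) :
  E != fset0 -> exists2 x, x \in E & {in E, forall y, (f y <= f x)%O}.
Proof.
case/fset0Pn=> x0 x0E.
case: (@Order.TotalTheory.arg_maxP _ _ _ [` x0E]%fset predT (fun x => f (val x)))
  => // x _ xmax.
by exists (val x) => [|y yE]; [exact: valP|exact: (xmax [` yE]%fset)].
Qed.

(** * Stages of the algorithm and backtracking *)

Section ForwardDP.
Variables (R : realType) (n : nat) (Sigma : {fset 'M[R]_n}) (a : 'cV[R]_n).
Implicit Types (E F : {fset 'cV[R]_n}) (k : nat) (x y : 'cV[R]_n).

Lemma imagesP E x :
  reflect (exists A y, [/\ A \in Sigma, y \in E & x = A *m y])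
          (x \in images Sigma E).
Proof.
apply: (iffP (bigfcupP _ _ _ _)) => [[A /andP[AS _] /imfsetP[y yE ->]]|].
  by exists A, y.
by move=> [A [y [AS yE ->]]]; exists A; rewrite ?AS //; apply/imfsetP; exists y.
Qed.

Lemma mem_extreme_filter F x :
  (x \in extreme_filter F) =
  (x \in F) && `[< extreme_points (convex_hull [set` F]) x >].
Proof. by rewrite !inE /=. Qed.

Lemma sub_hull_extreme_filter F :
  [set` F] `<=`
  convex_hull ([set` extreme_filter F] : set (convex_lmodType 'cV[R]_n)).
Proof.
apply: subset_trans (@minkowski_fset _ _ F) _.
apply: convex_hull_sub => x [xF xext]; apply: sub_convex_hull.
by rewrite /= mem_extreme_filter xF; apply/asboolP.
Qed.

Lemma final_state_rcons (T : seq 'M[R]_n) A :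
  final_state a (rcons T A) = A *m final_state a T.
Proof. by rewrite /final_state -cats1 foldl_cat. Qed.

(** Induction on [k], peeling off the matrix applied last: it maps the hull of one stage into the
    hull of the images, and filtering keeps that hull. *)
Lemma final_state_hull k (T : seq 'M[R]_n) : feasible Sigma k T ->
  convex_hull ([set` stage Sigma a k] : set (convex_lmodType 'cV[R]_n))
    (final_state a T).
Proof.
elim: k T => [|k IH] T [sT TS].
  by rewrite (size0nil sT); apply: sub_convex_hull; rewrite /= inE.
case/lastP: T sT TS => // T A; rewrite size_rcons => -[sT] TS.
have AS : A \in Sigma by apply: TS; rewrite mem_rcons mem_head.
have /IH Tk : feasible Sigma k T.
  by split=> // B BT; apply: TS; rewrite mem_rcons inE BT orbT.
rewrite final_state_rcons.
apply: convex_hull_sub (@convex_hull_linear _ _ _ (mulmx A) _ _ Tk).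
move=> _ [y yk <-]; apply: sub_hull_extreme_filter.
by apply/imagesP; exists A, y.
Qed.

Lemma backtrack_sound k x T : backtrack Sigma a k x T ->
  feasible Sigma k T /\ final_state a T = x.
Proof.
elim=> [|{}k {}x y A {}T yk AS -> _ [[sT TS] <-]]; first by split.
split; last exact: final_state_rcons.
split; first by rewrite size_rcons sT.
by move=> B; rewrite mem_rcons inE => /predU1P[->|/TS].
Qed.

(** Backtracking never gets stuck: filtering only discards points, so every retained point still has
    a predecessor in the preceding stage. *)
Lemma backtrack_exists k x :
  x \in stage Sigma a k -> exists T, backtrack Sigma a k x T.
Proof.
elim: k x => [|k IH] x.
  by rewrite inE => /eqP ->; exists [::]; constructor.
rewrite mem_extreme_filter => /andP[/imagesP[A [y [AS yk xE]]] _].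
by have [T bT] := IH _ yk; exists (rcons T A); exact: backtrackS xE bT.
Qed.

(** A constant sequence is feasible and its final state lies in the hull of the stage, whereas the
    hull of the empty set is empty. *)
Lemma stage_neq0 k : Sigma != fset0 -> stage Sigma a k != fset0.
Proof.
case/fset0Pn=> A AS; have : feasible Sigma k (nseq k A).
  by split; [exact: size_nseq|move=> B /nseqP[-> _]].
move=> /final_state_hull; apply: contraPneq => ->.
suff -> : [set` fset0] = set0 :> set (convex_lmodType 'cV[R]_n).
  by rewrite convex_hull_set0.
by apply/seteqP; split=> x //=; rewrite inE.
Qed.

End ForwardDP.

Theorem proposition1 (R : realType) (n : nat) (Sigma : {fset 'M[R]_n})
    (a : 'cV[R]_n) (K : nat) (f : 'cV[R]_n -> R)
    (Sigma_int : forall A, A \in Sigma -> A \is a mxOver Num.int)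
    (a_int : a \is a mxOver Num.int)
    (K_gt0 : (0 < K)%N)
    (f_convex : convex_function [set: 'cV[R]_n] f) :
  (Sigma != fset0 -> exists T, forward_dp Sigma a K f T) /\
  (forall T, forward_dp Sigma a K f T -> solves_P Sigma a K f T).
Proof.
split=> [S0|T [x [xK xmax /backtrack_sound[fT Tx]]]].
  have [x xK xmax] := fset_argmax f (stage_neq0 a K S0).
  by have [T bT] := backtrack_exists xK; exists T, x.
(* Every competing final state lies in the hull of the last stage, where [f] is bounded by its
   maximum [f x] over that stage. *)
split=> // T' /(@final_state_hull _ _ _ a).
by rewrite Tx; apply: convex_function_le_hull.
Qed.
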